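(* Consider the following random graph process: start with two vertices joined by an edge; at each time step choose an edge $\{u,w\}$ of the current graph uniformly at random, add a new vertex $v$, and add the edges $\{v,u\}$ and $\{v,w\}$. Let $C_n$ denote the average over all vertices of the local clustering coefficient of the graph at the time it has $n$ vertices ($n\ge 3$). Then the limiting average local clustering coefficient is $2\pi^2-19$, i.e. $$\lim_{n\to\infty}\mathbb{E}[C_n]=2\pi^2-19 .$$
   Context: The local clustering coefficient of a vertex $i$ of degree $d_i\ge 2$ in a simple graph is $\dfrac{2E_i}{d_i(d_i-1)}$, where $E_i$ is the number of edges among the neighbors of $i$. The process is Algorithm SE-A of the paper with parameter $z=1$ and initial graph consisting of two connected vertices. *)

(* Defs.v *)
From HB Require Import structures.
From mathcomp Require Import all_boot all_order all_algebra.
From mathcomp Require Import all_classical all_reals all_analysis.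

Set Implicit Arguments.
Unset Strict Implicit.
Unset Printing Implicit Defensive.

Import Order.TTheory GRing.Theory Num.Theory.
Import numFieldNormedType.Exports.

Local Open Scope ring_scope.

(* A simple graph on the vertices 0, ..., n-1 is given by its set of edges,
   each edge being the set of its two endpoints.  The type does not force edges
   to have cardinal 2; [path2] has this property and [attach] preserves it. *)
Notation graph n := {set {set 'I_n}}.

Section Clustering.
Context (n : nat) (g : graph n).

Definition neighbors (i : 'I_n) : {set 'I_n} :=
  [set j | (j != i) && ([set i; j]%SET \in g)]%SET.

Definition degree (i : 'I_n) : nat := #|neighbors i|.

Definition edges_among_neighbors (i : 'I_n) : nat :=
  #|[set f in g | f \subset neighbors i]%SET|.

(* Relevant only when [degree i >= 2]; otherwise the value is 0 because
   division by 0 yields 0. *)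
Definition local_clustering (R : realType) (i : 'I_n) : R :=
  2 * (edges_among_neighbors i)%:R / ((degree i)%:R * ((degree i)%:R - 1)).

Definition avg_clustering (R : realType) : R :=
  (\sum_(i < n) local_clustering R i) / n%:R.

End Clustering.

Definition path2 : graph 2 := [set [set: 'I_2]]%SET.

(* The old vertices keep their numbers ([lift ord_max] is the inclusion of
   'I_n into 'I_n.+1); the new vertex is n, i.e. [ord_max]. *)
Definition attach (n : nat) (g : graph n) (f : {set 'I_n}) : graph n.+1 :=
  ([set lift ord_max @: h | h : {set 'I_n} in g]
     :|: [set [set ord_max; lift ord_max u] | u in f])%SET.

Local Open Scope classical_set_scope.

(* G n is the graph when it has n vertices and E n is the edge then chosen (only
   n >= 2 matters).  In [choice_uniform] the conditioning on the value of G n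
   alone is conditioning on the whole past: since vertices are numbered in order
   of arrival, G n determines G 2, ..., G n.-1 and E 2, ..., E n.-1 (the edge
   E k consists of the neighbors of the vertex k among 0, ..., k-1). *)
Record is_edge_attachment_process (d : measure_display) (T : measurableType d)
    (R : realType) (P : probability T R)
    (G : forall n : nat, T -> graph n) (E : forall n : nat, T -> {set 'I_n}) :
    Prop := {
  graph_measurable : forall n (g : graph n), (2 <= n)%N ->
    measurable (G n @^-1` [set g]);
  choice_measurable : forall n (f : {set 'I_n}), (2 <= n)%N ->
    measurable (E n @^-1` [set f]);
  graph_init : forall w, G 2%N w = path2;
  choice_edge : forall n w, (2 <= n)%N ->
    E n w \in G n w;
  choice_uniform : forall n (g : graph n) (f : {set 'I_n}), (2 <= n)%N ->
    f \in g ->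
    P (G n @^-1` [set g] `&` E n @^-1` [set f])
      = (P (G n @^-1` [set g]) * (#|g|%:R^-1)%:E)%E;
  graph_step : forall n w, (2 <= n)%N -> G n.+1 w = attach (G n w) (E n w)
}.

(* Main.v *)
Require Import Defs.
From mathcomp Require Import all_boot all_order all_algebra.
From mathcomp Require Import all_classical all_reals all_analysis.
From mathcomp Require Import measurable_realfun.
From mathcomp Require Import ring lra zify.

(* Attaching a vertex to an edge at [i] raises the degree of [i] and the number
   of edges among its neighbors by one, so the two always differ by 1 and the
   local clustering coefficient of a vertex of degree k >= 2 is 2 / k.  As the
   graph on n vertices has 2n - 3 edges, the expected number M n k of vertices
   of degree k satisfies
     M (n+1) (k+1) = M n (k+1) (1 - (k+1)/(2n-3)) + M n k (k/(2n-3)) + [k+1 = 2],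
   which p_k (n - 3/2) with p_k = 12 / (k(k+1)(k+2)) solves exactly.  The l1-norm
   of the difference of the two solutions stays bounded, so E[C_n] tends to the
   sum of 2 p_k / k = 24 / (k^2 (k+1) (k+2)) over k >= 2, which Basel's sum
   evaluates to 2 pi^2 - 19. *)

Import Order.TTheory GRing.Theory Num.Theory.
Import numFieldNormedType.Exports.

Local Open Scope classical_set_scope.
Local Open Scope ring_scope.

(** * The Basel problem *)

Section Basel.
Context {R : realType}.
Implicit Types x : R.

Lemma sin_le_id x : 0 <= x -> sin x <= x.
Proof.
move=> x0; have [|c _] := @MVT_segment R sin cos 0 x x0.
  by apply: continuous_subspaceT; exact: continuous_sin.
by rewrite sin0 !subr0 => ->; rewrite ler_piMl // cos_le1.
Qed.

Lemma id_le_tan x : 0 <= x < pi / 2 -> x <= tan x.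
Proof.
move=> /andP[x0 xpi].
have cosN0 c : c \in `[0, x] -> 0 < cos c.
  rewrite in_itv /= => /andP[c0 cx]; apply: cos_gt0_pihalf.
  by rewrite (le_lt_trans cx xpi) andbT (lt_le_trans _ c0) // oppr_lt0 divr_gt0 // pi_gt0.
have [c cx| |c cx] := @MVT_segment R tan (fun c => (cos c)^-2) 0 x x0.
- by apply: is_derive_tan; rewrite gt_eqF // cosN0 // subset_itv_oo_cc.
- apply: continuous_in_subspaceT => c; rewrite inE => cx.
  by apply: continuous_tan; rewrite gt_eqF // cosN0.
rewrite tan0 !subr0 => ->; rewrite ler_peMl // invf_ge1.
  by rewrite exprn_ile1 ?cos_le1 // ltW // cosN0.
by rewrite exprn_gt0 // cosN0.
Qed.

(** Square and invert [sin x <= x <= tan x]; the lower bound is cot^2 x = csc^2 x - 1. *)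
Lemma csc2_bounds x : 0 < x < pi / 2 ->
  (sin x)^-2 - 1 <= x^-2 <= (sin x)^-2.
Proof.
move=> /andP[x0 xpi].
have sx : 0 < sin x by rewrite sin_gt0_pihalf // x0.
have cx : 0 < cos x.
  by rewrite cos_gt0_pihalf // xpi (lt_trans _ x0) // oppr_lt0 divr_gt0 // pi_gt0.
apply/andP; split; last first.
  by rewrite lef_pV2 ?posrE ?exprn_gt0 // lerXn2r ?nnegrE ?sin_le_id // ltW.
have -> : (sin x)^-2 - 1 = (tan x)^-2.
  rewrite /tan expr_div_n invf_div cos2sin2 mulrBl mul1r divff //.
  by rewrite gt_eqF // exprn_gt0.
have tx : x <= tan x by rewrite id_le_tan // (ltW x0).
have tx0 := lt_le_trans x0 tx.
by rewrite lef_pV2 ?posrE ?exprn_gt0 // lerXn2r ?nnegrE // ltW.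
Qed.

(** As sin (pi/2 - x) = cos x, the left side is 1 / (sin x cos x)^2, and sin (2x) = 2 sin x cos
    x. *)
Lemma csc2_double x : sin x != 0 -> cos x != 0 ->
  (sin x)^-2 + (sin (pi / 2 - x))^-2 = 4 * (sin (x *+ 2))^-2.
Proof.
move=> sx cx; rewrite -opprB sinN sinBpihalf opprK sin_mulr2n.
have -> : (sin x)^-2 + (cos x)^-2
    = (cos x ^+ 2 + sin x ^+ 2) / (cos x * sin x) ^+ 2 by field; rewrite sx.
by rewrite cos2Dsin2; field; rewrite sx.
Qed.

(* Pairing the angles [y] and [pi / 2 - y] turns the sum for [2 ^ n.+1] into
   four times the sum for [2 ^ n], plus the middle term [(sin (pi / 4))^-2]. *)
Lemma sum_csc2 n :
  \sum_(1 <= k < 2 ^ n) (sin (k%:R * pi / (2 ^ n.+1)%:R))^-2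
    = (2 * 4 ^+ n - 2) / 3 :> R.
Proof.
elim: n => [|n IHn].
  by rewrite big_geq // expr0 mulr1 subrr mul0r.
set N := (2 ^ n)%N in IHn *.
have N0 : (0 < N)%N by rewrite expn_gt0.
have -> : (2 ^ n.+1 = N + N)%N by rewrite expnS mul2n addnn.
have -> : (2 ^ n.+2 = 4 * N)%N by rewrite /N !expnS mulnA.
rewrite expnS -/N in IHn.
have NR : N%:R != 0 :> R by rewrite pnatr_eq0 -lt0n.
rewrite (@big_cat_nat _ _ _ N) ?leq_addl //= [X in _ + X]big_ltn; last first.
  by rewrite -[X in (X < _)%N]addn0 ltn_add2l.
have -> : N%:R * pi / (4 * N)%:R = pi / 4 :> R by rewrite natrM; field.
have -> : (sin (pi / 4 : R))^-2 = 2.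
  have := csc2_double (pi / 4).
  have -> : pi / 2 - pi / 4 = pi / 4 :> R by field.
  have -> : pi / 4 *+ 2 = pi / 2 :> R by rewrite -mulr_natr; field.
  have pi0 := @pi_gt0 R.
  rewrite sin_pihalf expr1n invr1 => h; suff: (sin (pi / 4) : R) ^- 2 + sin (pi / 4) ^- 2 = 4 * 1 by lra.
  apply: h.
  - by rewrite gt_eqF // sin_gt0_pihalf //; apply/andP; split; lra.
  - by rewrite gt_eqF // cos_gt0_pihalf //; apply/andP; split; lra.
(* The upper half is read backwards: the angle of index 2N - k is pi/2 minus the angle of index
   k. *)
rewrite addrCA [X in _ + (_ + X)](_ : _ = \sum_(1 <= k < N)
    (sin (pi / 2 - k%:R * pi / (4 * N)%:R))^-2); last first.
  rewrite -(addn1 N) addnC big_addn addnK [RHS]big_nat_rev /=.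
  apply: eq_big_nat => k /andP[_ kN]; rewrite add1n subSS natrB ?(ltnW kN) //.
  by congr (sin _ ^- 2); rewrite natrM natrD; field.
rewrite -big_split /=.
under eq_big_nat => k /andP[k1 kN].
  have k0 : 0 < k%:R :> R by rewrite ltr0n.
  have kNR : k%:R < N%:R :> R by rewrite ltr_nat.
  have pi0 := @pi_gt0 R.
  have NR0 : 0 < N%:R :> R by rewrite ltr0n.
  have yb : 0 < (k%:R * pi / (4 * N)%:R : R) < pi / 2.
    rewrite divr_gt0 ?mulr_gt0 ?ltr0n ?muln_gt0 //= natrM ltr_pdivrMr ?mulr_gt0 //.
    by nra.
  rewrite csc2_double; first last.
  - by rewrite gt_eqF // cos_gt0_pihalf //; case/andP: yb => *; apply/andP; split; lra.
  - by rewrite gt_eqF // sin_gt0_pihalf.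
  have -> : (k%:R * pi / (4 * N)%:R) *+ 2 = k%:R * pi / (2 * N)%:R :> R.
    by rewrite -mulr_natr !natrM; field.
  over.
by rewrite -mulr_sumr IHn exprS; field.
Qed.

Definition inverse_squares n : R := \sum_(1 <= k < n) k%:R^-2.

Lemma nondecreasing_inverse_squares : nondecreasing_seq inverse_squares.
Proof.
apply/nondecreasing_seqP => -[|n]; rewrite /inverse_squares.
  by rewrite !big_geq.
by rewrite [leRHS]big_nat_recr //= lerDl invr_ge0 exprn_ge0.
Qed.

(** Sum [csc2_bounds] over the angles k pi / (2N), N = 2^n, and evaluate both ends by [sum_csc2].
    The two ends differ by N - 1, which is negligible after division by 4 N^2 / pi^2. *)
Lemma inverse_squares_exp2 n :
  pi ^+ 2 / 6 * (1 - 2 * ((2 ^ n)%:R)^-1) <= inverse_squares (2 ^ n) <= pi ^+ 2 / 6.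
Proof.
set N := (2 ^ n)%N; have N1 : 1 <= N%:R :> R by rewrite ler1n expn_gt0.
have pi0 := @pi_gt0 R.
have csc2 (k : nat) : (1 <= k < N)%N ->
    (sin (k%:R * pi / (2 ^ n.+1)%:R : R))^-2 - 1
      <= 4 * N%:R ^+ 2 / pi ^+ 2 * k%:R^-2
      <= (sin (k%:R * pi / (2 ^ n.+1)%:R : R))^-2.
  move=> /andP[k0 kN]; rewrite expnS -/N natrM.
  have k0R : 0 < k%:R :> R by rewrite ltr0n.
  have kNR : k%:R < N%:R :> R by rewrite ltr_nat.
  have -> : 4 * N%:R ^+ 2 / pi ^+ 2 * k%:R^-2
      = (k%:R * pi / (2 * N%:R))^-2 :> R by field; rewrite !gt_eqF //; lra.
  apply: csc2_bounds; rewrite divr_gt0 ?mulr_gt0 //=; last by lra.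
  by rewrite ltr_pdivrMr ?mulr_gt0 //; [nra|lra].
have sumE := sum_csc2 n; rewrite -/N in sumE.
have NE : N%:R ^+ 2 = 4 ^+ n :> R by rewrite natrX -exprM mulnC exprM -natrX.
have [lo hi] : (2 * 4 ^+ n - 2) / 3 - (N%:R - 1)
      <= 4 * N%:R ^+ 2 / pi ^+ 2 * inverse_squares N
    /\ 4 * N%:R ^+ 2 / pi ^+ 2 * inverse_squares N <= (2 * 4 ^+ n - 2) / 3.
  rewrite -sumE /inverse_squares mulr_sumr; split; last first.
    by rewrite ler_sum_nat // => k /csc2 /andP[].
  have -> : N%:R - 1 = \sum_(1 <= k < N) (1 : R).
    by rewrite sumr_const_nat natrB // expn_gt0.
  by rewrite -sumrB ler_sum_nat // => k /csc2 /andP[].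
rewrite -NE in lo hi.
have -> : inverse_squares N = 4 * N%:R ^+ 2 / pi ^+ 2 * inverse_squares N
    * (pi ^+ 2 / (4 * N%:R ^+ 2)) by field; rewrite !gt_eqF //; lra.
have c0 : 0 < pi ^+ 2 / (4 * N%:R ^+ 2) :> R.
  by rewrite divr_gt0 ?mulr_gt0 ?exprn_gt0 //; lra.
apply/andP; split.
  apply: le_trans (ler_wpM2r (ltW c0) lo).
  rewrite -subr_ge0.
  have -> : ((2 * N%:R ^+ 2 - 2) / 3 - (N%:R - 1)) * (pi ^+ 2 / (4 * N%:R ^+ 2))
      - pi ^+ 2 / 6 * (1 - 2 / N%:R)
    = (N%:R + 1) * (pi ^+ 2 / (4 * N%:R ^+ 2)) / 3 :> R.
    by field; rewrite gt_eqF //; lra.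
  by rewrite divr_ge0 // mulr_ge0 // ?(ltW c0) //; lra.
apply: le_trans (ler_wpM2r (ltW c0) hi) _.
rewrite -subr_ge0.
have -> : pi ^+ 2 / 6 - (2 * N%:R ^+ 2 - 2) / 3 * (pi ^+ 2 / (4 * N%:R ^+ 2))
  = 2 / 3 * (pi ^+ 2 / (4 * N%:R ^+ 2)) :> R.
  by field; rewrite gt_eqF //; lra.
by rewrite mulr_ge0 // ltW.
Qed.

Lemma cvg_exp2 : (fun n => 2 ^ n)%N @ \oo --> \oo.
Proof.
apply/cvgnyPge => A; near=> n.
rewrite (leq_trans _ (ltnW (ltn_expl n (isT : 1 < 2)%N))) //.
by near: n; exact: nbhs_infty_ge.
Unshelve. all: by end_near. Qed.

(** Monotonicity and the upper bound give a limit; it is identified along the subsequence 2^n, where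
    the two-sided bounds hold. *)
Lemma cvg_inverse_squares : inverse_squares @ \oo --> pi ^+ 2 / 6.
Proof.
have ub : has_ubound (range inverse_squares).
  exists (pi ^+ 2 / 6) => _ [n _ <-].
  have /andP[_] := inverse_squares_exp2 n; apply: le_trans.
  by rewrite nondecreasing_inverse_squares // ltnW // ltn_expl.
have /cvg_ex[/= l cl] := nondecreasing_is_cvgn nondecreasing_inverse_squares ub.
suff <- : l = pi ^+ 2 / 6 by [].
apply: (@cvg_unique _ (@Rhausdorff R) (inverse_squares (2 ^ n) @[n --> \oo])).
  exact: cvg_comp cvg_exp2 cl.
apply: (@squeeze_cvgr _ _ _ _
  (fun n => pi ^+ 2 / 6 * (1 - 2 * ((2 ^ n)%:R)^-1)) (cst (pi ^+ 2 / 6))).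
- by near=> n; exact: inverse_squares_exp2.
- have : pi ^+ 2 / 6 * (1 - 2 * ((2 ^ n)%:R)^-1) @[n --> \oo]
      --> (pi ^+ 2 / 6 * (1 - 2 * 0) : R).
    apply: cvgMr; apply: cvgB; first exact: cvg_cst.
    apply: cvgMr.
    under eq_fun do rewrite natrX -exprVn.
    by apply: cvg_expr; rewrite ger0_norm; lra.
  by rewrite mulr0 subr0 mulr1.
- exact: cvg_cst.
Unshelve. all: by end_near. Qed.

End Basel.

(** * The degree recursion *)

Section DegreeRecursion.
Context {R : realType}.

(** The limiting proportion of vertices of degree k >= 2; these proportions sum to 1. *)
Definition degree_limit (k : nat) : R := 12 / (k%:R * (k%:R + 1) * (k%:R + 2)).

Lemma cvg_sum_degree_limit :
  \sum_(2 <= k < n) 2 / k%:R * degree_limit k @[n --> \oo] --> (2 * pi ^+ 2 - 19 : R).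
Proof.
(* Partial fractions: the summand is 12/k^2 - 18 (1/k - 1/(k+1)) + 6 (1/(k+1) - 1/(k+2)). The last
   two parts telescope to -9 + 2 plus remainders, and -12 removes the term k = 1 of
   [inverse_squares]. *)
have sumE n : \sum_(2 <= k < n.+2) 2 / k%:R * degree_limit k
    = 12 * inverse_squares n.+2 - 19 + 18 * n.+2%:R^-1 - 6 * n.+3%:R^-1 :> R.
  elim: n => [|n IHn].
    by rewrite big_geq // /inverse_squares big_nat1; field.
  rewrite big_nat_recr //= IHn /inverse_squares [in RHS]big_nat_recr //=.
  rewrite /degree_limit -!natr1; have n0 : 0 <= n%:R :> R by [].
  by field; rewrite !gt_eqF //; lra.
rewrite -(cvg_shiftn 2) /=.
under eq_fun do rewrite addn2 sumE.
have -> : 2 * pi ^+ 2 - 19 = 12 * (pi ^+ 2 / 6) - 19 + 18 * 0 - 6 * 0 :> R by field.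
have cvg_inv k : (n + k.+1)%:R^-1 @[n --> \oo] --> (0 : R).
  by have := @cvg_harmonic R; rewrite -(cvg_shiftn k); under eq_fun do rewrite /= -addnS.
apply: cvgB; last first.
  by apply: cvgMr; have := cvg_inv 2; under eq_fun do rewrite addnC.
apply: cvgD; last first.
  by apply: cvgMr; have := cvg_inv 1; under eq_fun do rewrite addnC.
apply: cvgB; last exact: cvg_cst.
apply: cvgMr; have := @cvg_inverse_squares R.
by rewrite -(cvg_shiftn 2); under eq_fun do rewrite addn2.
Qed.

(** The recursion is used from the triangle n = 3 on: then no vertex has degree 1, and k <= n <= 2n
    - 3 makes both transition weights nonnegative. *)
Context (M : nat -> nat -> R).
Hypothesis M3 : M 3 2 = 3.
Hypothesis M_one : forall n, (3 <= n)%N -> M n 1 = 0.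
Hypothesis M_diag : forall n, (3 <= n)%N -> M n n = 0.
Hypothesis M_step : forall n k, (3 <= n)%N ->
  M n.+1 k.+1 = M n k.+1 * (1 - k.+1%:R / (2 * n%:R - 3))
    + M n k * (k%:R / (2 * n%:R - 3)) + (k.+1 == 2)%:R.

Let dev n k := M n k - degree_limit k * (n%:R - 3 / 2).

(** Index 2 is separate because [dev n 1] is not 0 although [M n 1] is: [degree_limit 1] is 2. The
    source term 1 is absorbed by [degree_limit 2] = 1/2. *)
Let dev_two n : (3 <= n)%N ->
  dev n.+1 2 = dev n 2 * (1 - 2 / (2 * n%:R - 3)).
Proof.
move=> n3; have n3R : 3 <= n%:R :> R by rewrite ler_nat.
rewrite /dev M_step // M_one // /degree_limit /= -[n.+1%:R]natr1.
by field; rewrite !gt_eqF //; lra.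
Qed.

(** Since n - 3/2 is half of 2n - 3, the claim reduces to (k + 3) p_(k+1) = k p_k. *)
Let dev_step n k : (3 <= n)%N -> (2 <= k)%N ->
  dev n.+1 k.+1 = dev n k.+1 * (1 - k.+1%:R / (2 * n%:R - 3))
    + dev n k * (k%:R / (2 * n%:R - 3)).
Proof.
move=> n3 k2; have n3R : 3 <= n%:R :> R by rewrite ler_nat.
have k2R : 2 <= k%:R :> R by rewrite ler_nat.
rewrite /dev M_step // eqSS gtn_eqF // mulr0n addr0 /degree_limit.
rewrite -[n.+1%:R]natr1 -[k.+1%:R]natr1.
by field; rewrite !gt_eqF //; lra.
Qed.

(* The deviations satisfy the recursion without its source term, which moves
   mass from [k] to [k.+1] and hence does not increase the l1-norm; only the
   new index [k = n] contributes, with [12 / n - 12 / n.+1] at most. *)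
Lemma sum_degree_deviation n : (3 <= n)%N ->
  \sum_(2 <= k < n) `|M n k - degree_limit k * (n%:R - 3 / 2)| <= 7 - 12 / n%:R.
Proof.
elim: n => // n IHn; rewrite leq_eqVlt => /orP[/eqP[<-]|n3].
  (* For n = 3 the sum is 9/4 and the bound is 7 - 4; any constant from 25/4 on would serve in place
     of 7. *)
  rewrite big_nat1 M3 /degree_limit.
  have -> : 3 - 12 / (2 * (2 + 1) * (2 + 2)) * (3 - 3 / 2) = 9 / 4 :> R by field.
  by rewrite ger0_norm; lra.
have {}IHn : \sum_(2 <= k < n) `|dev n k| <= 7 - 12 / n%:R := IHn n3.
have n3R : 3 <= n%:R :> R by rewrite ler_nat.
set t := 2 * n%:R - 3 : R; have t0 : 0 < t by rewrite /t; lra.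
have stay k : (k <= n)%N -> `|1 - k%:R / t| = 1 - k%:R / t.
  move=> kn; have knR : k%:R <= n%:R :> R by rewrite ler_nat.
  by rewrite ger0_norm // subr_ge0 ler_pdivrMr // /t; lra.
have dev_nn : `|dev n n| <= 12 / n%:R - 12 / n.+1%:R.
  rewrite /dev M_diag // sub0r normrN /degree_limit ger0_norm; last first.
    by rewrite mulr_ge0 ?divr_ge0 ?mulr_ge0 //; lra.
  rewrite -[n.+1%:R]natr1 -subr_ge0.
  have -> : 12 / n%:R - 12 / (n%:R + 1) -
     12 / (n%:R * (n%:R + 1) * (n%:R + 2)) * (n%:R - 3 / 2)
     = 42 / (n%:R * (n%:R + 1) * (n%:R + 2)) :> R.
    by field; rewrite !gt_eqF //; lra.
  by rewrite divr_ge0 ?mulr_ge0 //; lra.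
suff step : \sum_(2 <= k < n.+1) `|dev n.+1 k|
    <= \sum_(2 <= k < n) `|dev n k| + `|dev n n|.
  by rewrite (le_trans step) // (le_trans (lerD IHn dev_nn)) // addrA subrK.
(* Each [|dev n k|] is split into the share that stays at k and the share that moves to k + 1. *)
have -> : \sum_(2 <= k < n) `|dev n k| + `|dev n n|
    = \sum_(2 <= k < n.+1) `|dev n k| * (1 - k%:R / t)
      + (\sum_(2 <= k < n) `|dev n k| * (k%:R / t) + `|dev n n| * (n%:R / t)).
  rewrite big_nat_recr //=; last by rewrite ltnW.
  rewrite addrACA -big_split /= -mulrDr subrK mulr1; congr (_ + _).
  by apply: eq_bigr => k _; rewrite -mulrDr subrK mulr1.
rewrite big_ltn; last by rewrite ltnS ltnW.
rewrite [X in _ <= X + _]big_ltn; last by rewrite ltnS ltnW.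
rewrite dev_two // normrM (stay 2%N (ltnW n3)) -addrA lerD2l.
rewrite !big_add1 /=.
(* The share leaving index n lands at n + 1, outside the sum, and is dropped. *)
rewrite addrA -big_split /=; apply: ler_wpDr.
  by rewrite mulr_ge0 // divr_ge0 //; exact: ltW.
apply: ler_sum_nat => k /andP[_ kn]; rewrite dev_step //.
apply: le_trans (ler_normD _ _) _; rewrite !normrM stay; last by lia.
by rewrite normr_nat -/t (@gtr0_norm _ t^-1) // invr_gt0.
Qed.

(** Because 2 / k <= 1, replacing [M n k] by [degree_limit k * (n - 3/2)] changes the quotient by at
    most 7 / n. *)
Lemma cvg_mean_inverse_degree :
  (\sum_(2 <= k < n) 2 / k%:R * M n k) / n%:R @[n --> \oo] --> (2 * pi ^+ 2 - 19 : R).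
Proof.
pose L n : R := \sum_(2 <= k < n) 2 / k%:R * degree_limit k.
have inv0 : (n%:R^-1 : R) @[n --> \oo] --> (0 : R).
  by rewrite -(cvg_shiftn 1); under eq_fun do rewrite addn1; exact: cvg_harmonic.
have main : L n * (1 - 3 / 2 * n%:R^-1) @[n --> \oo] --> (2 * pi ^+ 2 - 19 : R).
  have -> : 2 * pi ^+ 2 - 19 = (2 * pi ^+ 2 - 19) * (1 - 3 / 2 * 0) :> R by ring.
  apply: cvgM; first exact: cvg_sum_degree_limit.
  by apply: cvgB; [exact: cvg_cst|exact: cvgMr].
have err : 7 * n%:R^-1 @[n --> \oo] --> (0 : R).
  by rewrite -[X in _ --> X](mulr0 7); exact: cvgMr.
have lower : L n * (1 - 3 / 2 * n%:R^-1) - 7 * n%:R^-1 @[n --> \oo]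
    --> (2 * pi ^+ 2 - 19 - 0 : R) by exact: cvgB main err.
have upper : L n * (1 - 3 / 2 * n%:R^-1) + 7 * n%:R^-1 @[n --> \oo]
    --> (2 * pi ^+ 2 - 19 + 0 : R) by exact: cvgD main err.
rewrite subr0 in lower; rewrite addr0 in upper.
apply: (squeeze_cvgr _ lower upper); near=> n.
have n3 : (3 <= n)%N by near: n; exact: nbhs_infty_ge.
have n3R : 3 <= n%:R :> R by rewrite ler_nat.
rewrite -ler_distlC /=.
have -> : L n * (1 - 3 / 2 / n%:R) - (\sum_(2 <= k < n) 2 / k%:R * M n k) / n%:R
    = - (\sum_(2 <= k < n) 2 / k%:R * dev n k) / n%:R.
  have -> : \sum_(2 <= k < n) 2 / k%:R * dev n k
      = \sum_(2 <= k < n) 2 / k%:R * M n k - L n * (n%:R - 3 / 2).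
    rewrite /L mulr_suml -sumrB; apply: eq_bigr => k _.
    by rewrite /dev mulrBr mulrA.
  by field; rewrite gt_eqF //; lra.
rewrite mulNr normrN normrM [X in _ * X]ger0_norm ?invr_ge0 //.
rewrite ler_wpM2r ?invr_ge0 //.
have bound : \sum_(2 <= k < n) `|dev n k| <= 7.
  apply: (le_trans (sum_degree_deviation _ n3)).
  by rewrite gerBl divr_ge0.
apply: le_trans bound; apply: le_trans (ler_norm_sum _ _ _) _.
apply: ler_sum_nat => k /andP[k2 _]; rewrite normrM ler_piMl //.
have k2R : 2 <= k%:R :> R by rewrite ler_nat.
by rewrite ger0_norm ?divr_ge0 // ler_pdivrMr ?mul1r //; lra.
Unshelve. all: by end_near. Qed.

End DegreeRecursion.

(** * Attaching a vertex to an edge *)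

Lemma mem_neighbors n (g : graph n) (i j : 'I_n) :
  (j \in neighbors g i) = (j != i) && ([set i; j]%SET \in g).
Proof. by rewrite inE. Qed.

Section Attach.
Local Open Scope nat_scope.
Context {n : nat} (g : graph n) (f : {set 'I_n}).
Local Notation old := (lift (@ord_max n)).

Let old_inj : injective old := @lift_inj _ _.

(** Every new edge contains [ord_max], which is not in the range of [old]. *)
Lemma attach_old (h : {set 'I_n}) : (old @: h \in attach g f) = (h \in g).
Proof.
rewrite inE (mem_imset _ _ (imset_inj old_inj)).
case: (boolP (h \in g)) => //= _; apply/imsetP => -[u _ /setP/(_ ord_max)].
rewrite !inE eqxx /= => /imsetP[j _ /eqP]; apply/negP.
by rewrite neq_lift.
Qed.

Lemma attach_new u : ([set ord_max; old u]%SET \in attach g f) = (u \in f).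
Proof.
rewrite inE; have -> /= : ([set ord_max; old u]%SET
    \in [set old @: h | h : {set 'I_n} in g]%SET) = false.
  apply/imsetP => -[h _ /setP/(_ ord_max)]; rewrite !inE eqxx /=.
  by move/esym/imsetP => [j _ /eqP]; rewrite (negPf (neq_lift _ _)).
apply/imsetP/idP => [[v vf /setP/(_ (old u))]|uf]; last by exists u.
rewrite !inE eqxx orbT (inj_eq old_inj) eq_sym (negPf (neq_lift _ _)) /=.
by move/esym/eqP ->.
Qed.

Lemma neighbors_attach_old (i : 'I_n) :
  neighbors (attach g f) (old i) =
    ((old @: neighbors g i) :|: (if i \in f then [set ord_max] else finset.set0))%SET.
Proof.
apply/setP => k; rewrite mem_neighbors [RHS]finset.in_setU.
case: (unliftP ord_max k) => [j|] ->.
  rewrite (inj_eq old_inj) (mem_imset _ _ old_inj) mem_neighbors.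
  rewrite -(attach_old [set i; j]%SET) imsetU1 imset_set1.
  case: (i \in f); rewrite !inE ?orbF //.
  by rewrite [old j == _]eq_sym (negPf (neq_lift _ _)) orbF.
rewrite neq_lift /= (finset.setUC [set old i]%SET) attach_new.
have -> /= : (ord_max \in [set old x | x in neighbors g i]%SET) = false.
  by apply/imsetP => -[j _ /eqP]; rewrite (negPf (neq_lift _ _)).
by case: (i \in f); rewrite !inE ?eqxx.
Qed.

Lemma neighbors_attach_new :
  neighbors (attach g f) ord_max = (old @: f)%SET.
Proof.
apply/setP => k; rewrite mem_neighbors.
case: (unliftP ord_max k) => [j|] ->.
  rewrite attach_new (mem_imset _ _ old_inj).
  by rewrite eq_sym neq_lift.
rewrite eqxx /=; apply/esym/imsetP => -[j _ /eqP].
by rewrite (negPf (neq_lift _ _)).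
Qed.

Lemma degree_attach_old (i : 'I_n) :
  degree (attach g f) (old i) = (degree g i + (i \in f))%N.
Proof.
rewrite /degree neighbors_attach_old cardsU (card_imset _ old_inj).
have -> : (old @: neighbors g i :&: (if i \in f then [set ord_max] else finset.set0)
    = finset.set0)%SET.
  apply/setP => k; rewrite !inE; apply/andP => -[/imsetP[j _ ->]].
  by case: (i \in f); rewrite !inE // eq_sym (negPf (neq_lift _ _)).
by rewrite cards0 subn0; case: (i \in f); rewrite ?cards1 ?cards0.
Qed.

Lemma degree_attach_new : degree (attach g f) ord_max = #|f|.
Proof. by rewrite /degree neighbors_attach_new (card_imset _ old_inj). Qed.

Let new_edge_inj : injective (fun u => [set ord_max; old u]%SET).
Proof.
move=> u v /setP/(_ (old u)); rewrite !inE eqxx orbT (inj_eq old_inj).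
by rewrite eq_sym (negPf (neq_lift _ _)) /= => /esym/eqP.
Qed.

(** An arbitrary predicate serves both the total edge count and the edges inside a neighborhood. *)
Lemma card_edges_attach (p : pred {set 'I_n.+1}) :
  #|[set h in attach g f | p h]%SET| =
    (#|[set h in g | p (old @: h)]%SET|
      + #|[set u in f | p [set ord_max; old u]]%SET|)%N.
Proof.
rewrite -(card_imset _ (imset_inj old_inj)) -(card_imset _ new_edge_inj).
rewrite -cardsUI.
set A := imset _ _; set B := imset _ _.
have -> : (A :&: B = finset.set0)%SET.
  apply/setP => h; rewrite !inE; apply/andP => -[/imsetP[k _ ->] /imsetP[u _]].
  move=> /setP/(_ ord_max); rewrite !inE eqxx /=.
  by move/imsetP => [j _ /eqP]; rewrite (negPf (neq_lift _ _)).
rewrite cards0 addn0; congr #|pred_of_set _|; apply/setP => h; rewrite !inE.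
apply/andP/orP => [[/orP[]]|[]].
- by case/imsetP => k kg -> pk; left; apply/imsetP; exists k; rewrite // inE kg.
- by case/imsetP => u uf -> pu; right; apply/imsetP; exists u; rewrite // inE uf.
- case/imsetP => k; rewrite inE => /andP[kg pk] ->; split => //.
  by apply/orP; left; apply/imsetP; exists k.
- case/imsetP => k; rewrite inE => /andP[kg pk] ->; split => //.
  by apply/orP; right; apply/imsetP; exists k.
Qed.

Lemma card_attach : #|attach g f| = (#|g| + #|f|)%N.
Proof.
have := card_edges_attach predT.
have setId_predT (I : finType) (A : {set I}) : [set x in A | predT x]%SET = A.
  by apply/setP => x; rewrite inE andbT.
by rewrite !setId_predT.
Qed.

(** Old edges are unaffected. A new edge {v, u} lies among the neighbors of i only if i is in f and
    u is the other endpoint of f. *)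
Lemma edges_among_neighbors_attach_old (i : 'I_n) : f \in g -> #|f| = 2 ->
  edges_among_neighbors (attach g f) (old i)
    = (edges_among_neighbors g i + (i \in f))%N.
Proof.
move=> fg f2; rewrite /edges_among_neighbors card_edges_attach.
rewrite neighbors_attach_old; congr (_ + _)%N.
  apply: eq_card => h; rewrite !inE; congr (_ && _).
  apply/fintype.subsetP/fintype.subsetP => hN k.
    move=> kh; have := hN _ (imset_f old kh); rewrite inE.
    rewrite (mem_imset _ _ old_inj) => /orP[//|].
    by case: (i \in f); rewrite !inE // eq_sym (negPf (neq_lift _ _)).
  by case/imsetP => j jh ->; rewrite inE imset_f ?hN.
case: (boolP (i \in f)) => fi; last first.
  apply: eq_card0 => u; rewrite !inE; apply/andP => -[_ /fintype.subsetP/(_ ord_max)].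
  rewrite !inE eqxx /= orbF => /(_ isT) /imsetP[j _ /eqP].
  by rewrite (negPf (neq_lift _ _)).
have [w fE] : exists w, f :\ i = [set w]%SET.
  by apply/cards1P; move: (cardsD1 i f); rewrite fi f2 add1n => -[<-].
rewrite -[RHS](cards1 w); apply: eq_card => u; rewrite -fE !inE andbC.
case: (boolP (u \in f)) => uf; last by rewrite !andbF.
rewrite !andbT finset.subUset !finset.sub1set !inE eqxx orbT /= (mem_imset _ _ old_inj).
rewrite [old u == _]eq_sym (negPf (neq_lift _ _)) orbF !inE.
case: eqVneq => //= ui; suff -> : [set i; u]%SET = f by [].
(* Two distinct elements exhaust the two-element set f, and f is an edge of g. *)
apply/eqP; rewrite eqEcard finset.subUset !finset.sub1set fi uf f2 cards2 eq_sym.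
by rewrite ui.
Qed.

(** The neighbors of the new vertex are the endpoints of f, and by cardinality f is the only edge
    inside f. *)
Lemma edges_among_neighbors_attach_new :
  f \in g -> {in g, forall h : {set 'I_n}, #|h| = 2%N} ->
  edges_among_neighbors (attach g f) ord_max = 1%N.
Proof.
move=> fg g2; rewrite /edges_among_neighbors card_edges_attach.
rewrite neighbors_attach_new.
rewrite [X in (_ + X)%N](_ : _ = 0%N) ?addn0; last first.
  apply: eq_card0 => u; rewrite !inE; apply/andP => -[_ /fintype.subsetP/(_ ord_max)].
  rewrite !inE eqxx /= => /(_ isT) /imsetP[j _ /eqP].
  by rewrite (negPf (neq_lift _ _)).
rewrite -(cards1 f); apply: eq_card => h; rewrite !inE.
apply/andP/eqP => [[hg /fintype.subsetP hf]|->]; last by split.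
apply/eqP; rewrite eqEcard !g2 // leqnn andbT; apply/fintype.subsetP => k kh.
by have := hf _ (imset_f old kh); rewrite (mem_imset _ _ old_inj).
Qed.

End Attach.

(** * Trees of triangles and their degree counts *)

Lemma card_incident_edges n (g : graph n) (i : 'I_n) :
  {in g, forall h : {set 'I_n}, #|h| = 2%N} ->
  #|[set h in g | i \in h]%SET| = degree g i.
Proof.
move=> g2; rewrite /degree -(@card_in_imset _ _ (fun j => [set i; j]%SET)).
  apply: eq_card => h; rewrite !inE; apply/andP/imsetP => [[hg ih]|[j]].
    have [w hE] : exists w, h :\ i = [set w]%SET.
      by apply/cards1P; move: (cardsD1 i h); rewrite ih (g2 h hg) add1n => -[<-].
    have hiw : h = [set i; w]%SET by rewrite -hE finset.setD1K.
    exists w => //; rewrite inE -hiw hg andbT.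
    by have := set11 w; rewrite -hE !inE => /andP[].
  by rewrite inE => /andP[_ ijg] ->; rewrite !inE eqxx.
move=> j k; rewrite !inE => /andP[ji _] /andP[ki _] /setP/(_ j).
by rewrite !inE eqxx orbT (negPf ji) /= => /esym/eqP.
Qed.

(* The invariant of the process: all clustering coefficients are determined by
   the degrees, since a new edge at [i] always closes exactly one triangle. *)
Record tree_of_triangles {n} (g : graph n) : Prop := {
  card_edges : (#|g| + 3 = n.*2)%N;
  card_edge : {in g, forall f : {set 'I_n}, #|f| = 2%N};
  degreeE : forall i, degree g i = (edges_among_neighbors g i).+1
}.

Lemma tree_of_triangles_path2 : tree_of_triangles path2.
Proof.
split=> [|f|i]; first by rewrite cards1.
  by rewrite inE => /eqP ->; rewrite cardsT card_ord.
rewrite /degree /edges_among_neighbors; have -> : neighbors path2 i = [set~ i]%SET.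
  apply/setP => j; rewrite !inE; case: eqVneq => //= ji.
  by rewrite eqEcard finset.subsetT /= cardsT card_ord cards2 eq_sym ji.
rewrite cardsC1 card_ord; congr _.+1; apply/esym/eqP; rewrite cards_eq0.
apply/eqP/setP => f; rewrite !inE; apply/andP => -[/eqP ->].
by move/fintype.subsetP/(_ i); rewrite !inE eqxx => /(_ isT).
Qed.

Lemma tree_of_triangles_attach n (g : graph n) (f : {set 'I_n}) :
  tree_of_triangles g -> f \in g -> tree_of_triangles (attach g f).
Proof.
move=> [gn g2 gE] fg; split.
- by rewrite card_attach g2 // doubleS -gn; lia.
- move=> h; rewrite inE => /orP[] /imsetP[k kg ->].
    by rewrite card_imset ?g2 //; exact: lift_inj.
  by rewrite cards2 neq_lift.
- move=> k; case: (unliftP ord_max k) => [i|] ->.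
    by rewrite degree_attach_old edges_among_neighbors_attach_old ?g2 // gE.
  by rewrite degree_attach_new edges_among_neighbors_attach_new ?g2.
Qed.

(** A sum of booleans, so that it can be exchanged with sums over edges and over degrees. *)
Definition degree_count {n} (g : graph n) (k : nat) : nat :=
  (\sum_(i < n) (degree g i == k))%N.

Lemma degree_lt n (g : graph n) (i : 'I_n) : (degree g i < n)%N.
Proof.
rewrite -[X in (_ < X)%N]card_ord -cardsT; apply: proper_card.
rewrite properE finset.subsetT /=; apply/fintype.subsetPn; exists i => //.
by rewrite mem_neighbors eqxx.
Qed.

Lemma degree_count_ge n (g : graph n) k : (n <= k)%N -> degree_count g k = 0%N.
Proof.
move=> nk; apply: big1 => i _.
by rewrite ltn_eqF // (leq_trans (degree_lt _ _ _)).
Qed.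

Lemma degree_count_path2 k : degree_count path2 k = (2 * (k == 1))%N.
Proof.
have [_ _ degE] := tree_of_triangles_path2.
rewrite /degree_count (eq_bigr (fun=> (k == 1%N : nat))) ?sum_nat_const ?card_ord // => i _.
have -> : degree path2 i = 1%N; last by rewrite eq_sym.
by apply/eqP; rewrite eqn_leq -ltnS degree_lt degE.
Qed.

Lemma degree_count_attach n (g : graph n) (f : {set 'I_n}) k : #|f| = 2%N ->
  degree_count (attach g f) k
    = (\sum_(i < n) (degree g i + (i \in f) == k) + (k == 2))%N.
Proof.
move=> f2; rewrite /degree_count (bigD1 ord_max) //= degree_attach_new f2.
rewrite addnC eq_sym; congr (_ + _)%N.
rewrite (reindex_omap (lift ord_max) (unlift ord_max)); last first.
  by move=> i; case: unliftP => [j|] -> //; rewrite eqxx.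
apply: eq_big => [i|i _]; first by rewrite liftK eqxx andbT eq_sym neq_lift.
by rewrite degree_attach_old.
Qed.

(** Double counting of pairs (vertex, chosen edge): a vertex of degree m gains a neighbor for
    exactly m choices of f. The loss term stands on the left to avoid subtraction in [nat]. *)
Lemma sum_degree_count_attach n (g : graph n) k : tree_of_triangles g ->
  (\sum_(f in g) degree_count (attach g f) k.+1 + k.+1 * degree_count g k.+1)%N
    = (#|g| * degree_count g k.+1 + k * degree_count g k + #|g| * (k == 1))%N.
Proof.
move=> [_ g2 _].
under eq_bigr => f fg do rewrite degree_count_attach ?g2 // eqSS.
rewrite big_split /= sum_nat_const addnAC; congr (_ + _)%N.
rewrite exchange_big /= /degree_count !big_distrr /= -!big_split /=.
apply: eq_bigr => i _.
have degE : degree g i = (\sum_(f in g) (i \in f))%N.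
  rewrite -card_incident_edges // -sum1_card big_mkcond [RHS]big_mkcond /=.
  by apply: eq_bigr => f _; rewrite inE; case: (f \in g); case: (i \in f).
(* The factor m may be replaced by the degree of i, that is, by a sum over edges; the identity then
   holds for each pair (i, f) separately. *)
have mulE m : (m * (degree g i == m)
    = \sum_(f in g) (i \in f) * (degree g i == m))%N.
  by rewrite -big_distrl /= -degE; case: eqP => [->|_] //; rewrite !muln0.
rewrite (mulE k.+1) (mulE k) -sum_nat_const -!big_split /=.
apply: eq_bigr => f _; case: (i \in f) => /=; last by rewrite !addn0.
by rewrite addn1 eqSS !mul1n addnC.
Qed.

(** With d - 1 edges among d >= 2 neighbors the coefficient is 2 / d. For smaller degree there is no
    such edge and the numerator is 0. *)
Lemma avg_clusteringE (R : realType) n (g : graph n) : tree_of_triangles g ->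
  avg_clustering g R = (\sum_(2 <= k < n) 2 / k%:R * (degree_count g k)%:R) / n%:R.
Proof.
move=> [_ _ gE]; rewrite /avg_clustering; congr (_ / _).
under [RHS]eq_bigr do rewrite /degree_count natr_sum mulr_sumr.
rewrite exchange_big /=; apply: eq_bigr => i _; rewrite /local_clustering.
have [d1|d1] := leqP (degree g i) 1.
  have -> : edges_among_neighbors g i = 0%N by move: (gE i) d1; lia.
  rewrite mulr0 mul0r big_nat_cond big1 // => k /andP[/andP[k2 _] _].
  by rewrite ltn_eqF ?mulr0 // (leq_ltn_trans d1).
rewrite (@big_cat_nat _ _ _ (degree g i)) //=; last by rewrite ltnW // degree_lt.
rewrite big_nat_cond big1 ?add0r => [|k /andP[/andP[_ kd] _]]; last first.
  by rewrite gtn_eqF ?mulr0.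
rewrite big_ltn ?degree_lt // eqxx mulr1 big_nat_cond big1 ?addr0; last first.
  by move=> k /andP[/andP[kd _] _]; rewrite ltn_eqF ?mulr0.
have -> : (edges_among_neighbors g i)%:R = (degree g i)%:R - 1 :> R.
  by rewrite gE -natr1 addrK.
have dR : 1 < (degree g i)%:R :> R by rewrite ltr1n.
by field; rewrite !gt_eqF //; lra.
Qed.

(** * Expectations along the random process *)

Lemma expectation_finite d (T : measurableType d) (R : realType)
    (P : probability T R) (I : finType) (X : T -> I) (h : I -> R) :
  (forall x, measurable (X @^-1` [set x])) -> (forall x, 0 <= h x) ->
  'E_P[h \o X]%E = (\sum_x h x * fine (P (X @^-1` [set x])))%:E.
Proof.
move=> mX h0; rewrite unlock.
(* Writing the integrand as a finite sum of weighted indicators requires no sigma-algebra on [I]. *)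
have -> : (fun w => ((h \o X) w)%:E)
    = (fun w => \sum_x (h x * \1_(X @^-1` [set x]) w)%:E)%E.
  apply/funext => w; rewrite sumEFin (bigD1 (X w)) //= big1 ?addr0 => [|x xX].
    by rewrite indicE mem_set // mulr1.
  rewrite indicE memNset ?mulr0 //= => /esym/eqP; exact/negP.
rewrite ge0_integral_sum //=.
- rewrite -sumEFin; apply: eq_bigr => x _.
  rewrite (@integralZl_indic _ _ _ _ _ _ (fun=> X @^-1` [set x])) //; last first.
    by move=> hx; have := h0 x; rewrite leNgt hx.
  by rewrite integral_indic // setIT EFinM fineK // fin_num_measure.
- by move=> x; apply/measurable_EFinP; exact: measurable_funM.
- by move=> x w _; rewrite lee_fin mulr_ge0.
Qed.

Section Process.
Context {d : measure_display} {T : measurableType d} {R : realType}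
  {P : probability T R} {G : forall n : nat, T -> graph n}
  {E : forall n : nat, T -> {set 'I_n}}.
Hypothesis process : is_edge_attachment_process P G E.

Lemma process_tree_of_triangles n w : (2 <= n)%N -> tree_of_triangles (G n w).
Proof.
elim: n => // n IHn; rewrite leq_eqVlt => /orP[/eqP[<-]|n2].
  by rewrite (graph_init process); exact: tree_of_triangles_path2.
rewrite (graph_step process) //; apply: tree_of_triangles_attach; first exact: IHn.
exact: (choice_edge process).
Qed.

(** The expectation of [h (G n)] as a finite real sum, so that the recursion becomes algebra in
    [R]. *)
Definition mean n (h : graph n -> R) : R :=
  \sum_g h g * fine (P (G n @^-1` [set g])).

Lemma expectation_mean n (h : graph n -> R) : (2 <= n)%N ->
  (forall g, 0 <= h g) -> 'E_P[h \o G n]%E = (mean n h)%:E.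
Proof.
move=> n2 h0; rewrite expectation_finite // => g.
exact: (graph_measurable process).
Qed.

(** Graphs violating the invariant are never reached, so they have weight 0. *)
Lemma eq_mean n (h h' : graph n -> R) : (2 <= n)%N ->
  (forall g, tree_of_triangles g -> h g = h' g) -> mean n h = mean n h'.
Proof.
move=> n2 hh'; apply: eq_bigr => g _; have [tg|tg] := pselect (tree_of_triangles g).
  by rewrite hh'.
rewrite (_ : G n @^-1` [set g] = set0) ?measure0 ?mulr0 //.
apply/seteqP; split => // w /= Gw; apply: tg; rewrite -Gw.
exact: process_tree_of_triangles.
Qed.

Lemma mean_cst n c : (2 <= n)%N -> mean n (fun=> c) = c.
Proof.
move=> n2; suff : mean n (fun=> 1) = 1.
  by rewrite /mean -!mulr_sumr mul1r => ->; rewrite mulr1.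
apply: EFin_inj; rewrite -expectation_mean //.
by rewrite (_ : _ \o _ = cst 1) // expectation_cst.
Qed.

Lemma mean_step n (h : graph n.+1 -> R) : (2 <= n)%N -> (forall g, 0 <= h g) ->
  mean n.+1 h = mean n (fun g => #|g|%:R^-1 * \sum_(f in g) h (attach g f)).
Proof.
move=> n2 h0; apply: EFin_inj; rewrite -expectation_mean //; last exact: ltnW.
(* The next graph is a function of this pair, whose law is given by [choice_uniform] on edges of g
   and is 0 off them. *)
pose GE w := (G n w, E n w).
have GE_preimage gf : GE @^-1` [set gf]
    = G n @^-1` [set gf.1] `&` E n @^-1` [set gf.2].
  case: gf => g f; apply/seteqP; split => w /=; first by case=> <- <-.
  by case=> <- <-.
have -> : h \o G n.+1 = (fun gf => h (attach gf.1 gf.2)) \o GE.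
  by apply/funext => w /=; rewrite (graph_step process).
rewrite expectation_finite //; last first.
  move=> gf; rewrite GE_preimage; apply: measurableI.
    exact: (graph_measurable process).
  exact: (choice_measurable process).
congr EFin; transitivity
  (\sum_g \sum_f h (attach g f) * fine (P (GE @^-1` [set (g, f)]))).
  by rewrite pair_bigA; apply: eq_bigr => -[g f] _.
apply: eq_bigr => g _.
rewrite (bigID (mem g)) /= [X in _ + X]big1 ?addr0 => [|f fg]; last first.
  rewrite (_ : _ @^-1` _ = set0) ?measure0 ?mulr0 //.
  apply/seteqP; split => // w [Gw Ew]; apply: (negP fg).
  by rewrite -Gw -Ew; exact: (choice_edge process).
rewrite mulrC mulrA mulr_sumr; apply: eq_bigr => f fg.
rewrite GE_preimage (choice_uniform process) //.
rewrite fineM ?fin_num_measure //=; first by rewrite mulrC.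
exact: (graph_measurable process).
Qed.

Definition mean_degree_count n k : R := mean n (fun g => (degree_count g k)%:R).

(** This is [sum_degree_count_attach] divided by the number of edges, which is 2n - 3 for every
    reachable graph and so comes out of the mean. *)
Lemma mean_degree_count_step n k : (2 <= n)%N ->
  mean_degree_count n.+1 k.+1
    = mean_degree_count n k.+1 * (1 - k.+1%:R / (2 * n%:R - 3))
      + mean_degree_count n k * (k%:R / (2 * n%:R - 3)) + (k.+1 == 2)%:R.
Proof.
move=> n2; rewrite /mean_degree_count mean_step // -(mean_cst n (k.+1 == 2)%:R) //.
rewrite {2 3 4}/mean !mulr_suml -!big_split /=.
transitivity (mean n (fun g => (degree_count g k.+1)%:R * (1 - k.+1%:R / (2 * n%:R - 3))
  + (degree_count g k)%:R * (k%:R / (2 * n%:R - 3)) + (k.+1 == 2)%:R)); last first.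
  by apply: eq_bigr => g _; ring.
apply: eq_mean => // g tg.
have n2R : 2 <= n%:R :> R by rewrite ler_nat.
have gR : #|g|%:R = 2 * n%:R - 3 :> R.
  by rewrite -natrM mul2n -(card_edges _ tg) natrD addrK.
have t0 : 2 * n%:R - 3 != 0 :> R by rewrite gt_eqF //; lra.
have := congr1 (fun m => m%:R : R) (sum_degree_count_attach _ g k tg).
rewrite !natrD !natrM natr_sum gR => /(canRL (addrK _)) sumE.
by apply: (mulfI t0); rewrite mulVKf // sumE eqSS; field.
Qed.

Lemma mean_degree_count2 k : mean_degree_count 2 k = (2 * (k == 1))%:R.
Proof.
apply: EFin_inj; rewrite -expectation_mean //.
rewrite (_ : _ \o _ = cst (2 * (k == 1))%:R) ?expectation_cst //.
by apply/funext => w /=; rewrite (graph_init process) degree_count_path2.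
Qed.

Lemma mean_degree_count_ge n k : (n <= k)%N -> mean_degree_count n k = 0.
Proof.
by move=> nk; apply: big1 => g _; rewrite degree_count_ge // mul0r.
Qed.

Lemma mean_degree_count3 : mean_degree_count 3 2 = 3.
Proof. by rewrite mean_degree_count_step // !mean_degree_count2 /=; field. Qed.

(** At n = 2 the survival factor 1 - 1 / (2n - 3) is 0; later the inflow from degree 0 has weight
    0. *)
Lemma mean_degree_count_one n : (3 <= n)%N -> mean_degree_count n 1 = 0.
Proof.
elim: n => // n IHn; rewrite leq_eqVlt => /orP[/eqP[<-]|n3].
  by rewrite mean_degree_count_step // !mean_degree_count2 /=; field.
have n2 : (2 <= n)%N := ltnW n3.
by rewrite mean_degree_count_step // IHn // !mul0r mulr0 !add0r.
Qed.

Lemma expectation_avg_clustering n : (2 <= n)%N ->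
  'E_P[fun w => avg_clustering (G n w) R]%E
    = ((\sum_(2 <= k < n) 2 / k%:R * mean_degree_count n k) / n%:R)%:E.
Proof.
move=> n2.
pose h (g : graph n) : R := (\sum_(2 <= k < n) 2 / k%:R * (degree_count g k)%:R) / n%:R.
have -> : (fun w => avg_clustering (G n w) R) = h \o G n.
  apply/funext => w; apply: avg_clusteringE; exact: process_tree_of_triangles.
rewrite expectation_mean // => [|g]; last first.
  by rewrite divr_ge0 // sumr_ge0 // => k _; rewrite mulr_ge0 ?divr_ge0.
congr EFin; rewrite /mean /h.
under eq_bigr do rewrite mulrAC mulr_suml.
rewrite -mulr_suml exchange_big /=; congr (_ / _); apply: eq_bigr => k _.
by rewrite mulr_sumr; apply: eq_bigr => g _; rewrite mulrA.
Qed.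

End Process.

Theorem theorem8 (d : measure_display) (T : measurableType d) (R : realType)
    (P : probability T R)
    (G : forall n : nat, T -> graph n) (E : forall n : nat, T -> {set 'I_n}) :
  is_edge_attachment_process P G E ->
  (fun n : nat => 'E_P[fun w => avg_clustering (G n w) R]%E) @ \oo
    --> (2 * pi ^+ 2 - 19 : R)%:E.
Proof.
move=> process.
have lim := cvg_mean_inverse_degree _ (mean_degree_count3 process)
  (mean_degree_count_one process) (fun n _ => mean_degree_count_ge n n (leqnn n))
  (fun n k n3 => mean_degree_count_step process n k (ltnW n3)).
(* Finiteness and the formula for the expectation are available for n >= 2, hence eventually. *)
apply: cvg_EFin; last first.
  apply: cvg_trans lim; apply: near_eq_cvg; near=> n.
  rewrite /= (expectation_avg_clustering process) //.
  by near: n; exact: nbhs_infty_ge.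
near=> n; rewrite (expectation_avg_clustering process) //.
by near: n; exact: nbhs_infty_ge.
Unshelve. all: by end_near. Qed.
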